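(* Let $\varphi_e$ and $\varphi_{e_1}$ form a Mannheim surface offset, with dual Lorentzian offset angle $\bar\theta=\theta+\varepsilon\theta^*$. Then $$\Delta_1=-\theta^*\tanh\theta+\frac{\delta}{\gamma}$$ holds.
   Context: Minkowski space $\mathbb{R}^3_1$ is $\mathbb{R}^3$ with $\langle \vec a,\vec b\rangle=-a_1b_1+a_2b_2+a_3b_3$, and the Lorentzian cross product is $\vec a\times\vec b=(a_2b_3-a_3b_2,\ a_1b_3-a_3b_1,\ a_2b_1-a_1b_2)$. Dual numbers are $a+\varepsilon a^*$ with $a,a^*\in\mathbb{R}$, $\varepsilon^2=0$; dual vectors are $\vec a+\varepsilon\vec a^*$ with $\vec a,\vec a^*\in\mathbb{R}^3_1$; inner and cross products extend bilinearly over the dual numbers. A differentiable real function $f$ extends to dual numbers by $f(x+\varepsilon x^* )=f(x)+\varepsilon x^*f'(x)$. First surface (spacelike ruled surface): $\varphi_e(s,v)=\vec c(s)+v\,\vec e(s)$ with smooth $\vec c,\vec e$ on an interval containing $0$, $\langle\vec e,\vec e\rangle=1$, $\langle\vec e\,',\vec e\,'\rangle=-1$, $\langle\vec c\,',\vec e\,'\rangle=0$ (prime is $d/ds$; $s$ is the arc-length of the indicatrix $\vec e$, and $\vec c$ is the striction curve). Put $\vec t=\vec e\,'$, $\vec g=-\vec e\times\vec t$; then $\vec t\,'=\vec e+\gamma\vec g$, $\vec g\,'=\gamma\vec t$, which defines the conical curvature $\gamma$. Put $\Delta=\det(\vec c\,',\vec e,\vec t)$, $\delta=\langle\vec c\,',\vec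 e\rangle$, and $\tilde x=\vec x+\varepsilon\,\vec c\times\vec x$ for $\vec x=\vec e,\vec t,\vec g$. The dual arc-length is $\bar s=s+\varepsilon s^*$, $s^*=\int_0^s\Delta\,du$. The dual Darboux frame $\{\tilde e,\tilde t,\tilde g\}$ satisfies $\frac{d\tilde e}{d\bar s}=\tilde t$, $\frac{d\tilde t}{d\bar s}=\tilde e+\bar\gamma\tilde g$, $\frac{d\tilde g}{d\bar s}=\bar\gamma\tilde t$ with $\bar\gamma=\gamma-\varepsilon(\delta+\gamma\Delta)$. Second surface (timelike ruled surface with timelike rulings): $\varphi_{e_1}(s_1,v)=\vec c_1(s_1)+v\,\vec e_1(s_1)$ with $\langle\vec e_1,\vec e_1\rangle=-1$, $s_1$ the arc-length of the indicatrix $\vec e_1$, $\vec t_1=\frac{d\vec e_1}{ds_1}$ with $\langle\vec t_1,\vec t_1\rangle=1$, $\langle\frac{d\vec c_1}{ds_1},\vec t_1\rangle=0$ ($\vec c_1$ is the striction curve). Put $\Delta_1=\det(\frac{d\vec c_1}{ds_1},\vec e_1,\vec t_1)$. Its dual arc-length is $\bar s_1=s_1+\varepsilon s_1^*$, $s_1^*=-\int_0^{s_1}\Delta_1du_1$. Its dual Darboux frame is $\{\tilde e_1,\tilde t_1,\tilde g_1\}$, $\tilde x_1=\vec x_1+\varepsilon\,\vec c_1\times\vec x_1$, with $\tilde t_1=\frac{d\tilde e_1}{d\bar s_1}$. Mannheim offsets: $\varphi_e$ and $\varphi_{e_1}$ (with corresponding points, $s_1$ being a regular function of $s$, i.e.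 $\frac{ds_1}{ds}\neq0$) form a Mannheim surface offset if $\tilde g(\bar s)=\tilde t_1(\bar s_1)$. The frames are then related by $$\tilde e_1=\sinh\bar\theta\,\tilde e+\cosh\bar\theta\,\tilde t,\quad \tilde t_1=\tilde g,\quad \tilde g_1=\cosh\bar\theta\,\tilde e+\sinh\bar\theta\,\tilde t,$$ where the dual function $\bar\theta=\theta+\varepsilon\theta^*$ is the dual Lorentzian offset angle; the real functions $\theta$ and $\theta^*$ are called the offset angle and the offset distance. Quantities of the two surfaces are compared at corresponding parameters $s$, $s_1$. *)

(* Defs.v *)
From Stdlib Require Import Reals.
From Coquelicot Require Import Coquelicot.
Open Scope R_scope.

(** * Calculus on an interval *)

(* A nondegenerate interval (open, closed or half-open, possibly unbounded)
   containing 0. *)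
Definition interval_containing_0 (I : R -> Prop) : Prop :=
  I 0 /\ (exists x, I x /\ x <> 0) /\
  (forall x y z, I x -> I y -> x <= z <= y -> I z).

(* Derivative relative to [I]: the usual derivative at interior points of [I],
   the one-sided derivative at an endpoint belonging to [I]. *)
Definition is_derive_in (I : R -> Prop) {V : NormedModule R_AbsRing}
    (f : R -> V) (x : R) (l : V) : Prop :=
  filterdiff f (within I (locally x)) (fun h => scal h l).

Definition smooth_in (I : R -> Prop) {V : NormedModule R_AbsRing}
    (f : R -> V) : Prop :=
  exists D : nat -> R -> V,
    (forall x, I x -> D 0%nat x = f x) /\
    (forall n x, I x -> is_derive_in I (D n) x (D (S n) x)).

(** * Minkowski 3-space *)

Definition R31 : NormedModule R_AbsRing :=
  prod_NormedModule R_AbsRing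
    (prod_NormedModule R_AbsRing R_NormedModule R_NormedModule) R_NormedModule.

Definition x1 (a : R31) : R := fst (fst a).
Definition x2 (a : R31) : R := snd (fst a).
Definition x3 (a : R31) : R := snd a.

Definition inner (a b : R31) : R :=
  - (x1 a * x1 b) + x2 a * x2 b + x3 a * x3 b.

(* The sign pattern is the Lorentzian one; it gives
   [inner (cross a b) d = - det a b d]. *)
Definition cross (a b : R31) : R31 :=
  (x2 a * x3 b - x3 a * x2 b,
   x1 a * x3 b - x3 a * x1 b,
   x2 a * x1 b - x1 a * x2 b).

Definition det (a b d : R31) : R :=
  x1 a * (x2 b * x3 d - x3 b * x2 d)
  - x2 a * (x1 b * x3 d - x3 b * x1 d)
  + x3 a * (x1 b * x2 d - x2 b * x1 d).

(** * Dual numbers and dual vectors *)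

(* The pair [(a, a')] stands for [a + eps a'], with [eps ^ 2 = 0]. *)
Definition dual : Type := (R * R)%type.
Definition dual_vec : Type := (R31 * R31)%type.

Definition dual_add (a b : dual_vec) : dual_vec :=
  (plus (fst a) (fst b), plus (snd a) (snd b)).

Definition dual_scal (k : dual) (a : dual_vec) : dual_vec :=
  (scal (fst k) (fst a),
   plus (scal (fst k) (snd a)) (scal (snd k) (fst a))).

(* [f (x + eps x') = f x + eps x' f' x], for [f] differentiable. *)
Definition dual_ext (f : R -> R) (z : dual) : dual :=
  (f (fst z), snd z * Derive f (fst z)).

(* The dual vector [x + eps (c /\ x)] of the oriented line through the point
   [c] with direction [x]. *)
Definition tilde (c x : R31) : dual_vec := (x, cross c x).

(** * Ruled surfaces [c s + v e s] *)

(* In both records [dc] and [t] are the derivatives of [c] and [e]. The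
   parameter is the arc-length of the indicatrix [e], and [c] is the striction
   curve. *)
Record spacelike_ruled_surface (I : R -> Prop) (c e dc t : R -> R31) : Prop := {
  sl_dom : interval_containing_0 I;
  sl_smooth_c : smooth_in I c;
  sl_smooth_e : smooth_in I e;
  sl_dc : forall s, I s -> is_derive_in I c s (dc s);
  sl_t : forall s, I s -> is_derive_in I e s (t s);
  sl_unit : forall s, I s -> inner (e s) (e s) = 1;
  sl_arclength : forall s, I s -> inner (t s) (t s) = -1;
  sl_striction : forall s, I s -> inner (dc s) (t s) = 0
}.

Record timelike_ruled_surface (I : R -> Prop) (c e dc t : R -> R31) : Prop := {
  tl_dom : interval_containing_0 I;
  tl_smooth_c : smooth_in I c;
  tl_smooth_e : smooth_in I e;
  tl_dc : forall s, I s -> is_derive_in I c s (dc s);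
  tl_t : forall s, I s -> is_derive_in I e s (t s);
  tl_unit : forall s, I s -> inner (e s) (e s) = -1;
  tl_arclength : forall s, I s -> inner (t s) (t s) = 1;
  tl_striction : forall s, I s -> inner (dc s) (t s) = 0
}.

(* Third vector of the Darboux frame. The same formula serves a timelike
   ruling: it is the orientation compatible with the relations in
   [dual_offset_angle], since there [e1 /\ t1 = - (cosh e + sinh t)]. *)
Definition darboux_g (e t : R31) : R31 := opp (cross e t).

Definition conical_curvature (I : R -> Prop) (e t : R -> R31) (gamma : R -> R)
    : Prop :=
  forall s, I s ->
    is_derive_in I t s (plus (e s) (scal (gamma s) (darboux_g (e s) (t s)))).

Definition surf_delta (dc e : R -> R31) (s : R) : R := inner (dc s) (e s).

Definition surf_Delta (dc e t : R -> R31) (s : R) : R := det (dc s) (e s) (t s).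

(** * Mannheim offsets *)

(* Dual arc-lengths are functions of the real parameters, so a frame vector at
   dual arc-length [s + eps s'] is the one at the real parameter [s]. The point
   [s] of the first surface corresponds to the point [s1 s] of the second. *)
Record mannheim_offset (I J : R -> Prop)
    (c e t : R -> R31) (c1 t1 : R -> R31) (s1 : R -> R) : Prop := {
  mo_dom : forall s, I s -> J (s1 s);
  mo_regular : forall s, I s ->
    exists d, d <> 0 /\ is_derive_in I (V := R_NormedModule) s1 s d;
  mo_offset : forall s, I s ->
    tilde (c s) (darboux_g (e s) (t s)) = tilde (c1 (s1 s)) (t1 (s1 s))
}.

Definition dual_offset_angle (I : R -> Prop)
    (c e t : R -> R31) (c1 e1 t1 : R -> R31) (s1 : R -> R)
    (theta theta_star : R -> R) : Prop :=
  forall s, I s ->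
    let E := tilde (c s) (e s) in
    let T := tilde (c s) (t s) in
    let G := tilde (c s) (darboux_g (e s) (t s)) in
    let E1 := tilde (c1 (s1 s)) (e1 (s1 s)) in
    let T1 := tilde (c1 (s1 s)) (t1 (s1 s)) in
    let G1 := tilde (c1 (s1 s)) (darboux_g (e1 (s1 s)) (t1 (s1 s))) in
    let th : dual := (theta s, theta_star s) in
    E1 = dual_add (dual_scal (dual_ext sinh th) E)
                  (dual_scal (dual_ext cosh th) T) /\
    T1 = G /\
    G1 = dual_add (dual_scal (dual_ext cosh th) E)
                  (dual_scal (dual_ext sinh th) T).

(* Main.v *)
(* Write g for [darboux_g e t] and D for [c1 (s1 s) - c s]. Comparing moments,
   t1 = g and D is parallel to g, with <D, g> = theta'. Differentiating
   <D, e> = <D, t> = 0 gives s1' <dc1, e> = delta and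
   s1' <dc1, t> = - gamma theta', while differentiating det (e1, e, t) = 0 gives
   s1' = gamma cosh theta. The formula follows by expanding e1 in
   Delta1 = det (dc1, e1, g); regularity s1' <> 0 forces gamma <> 0. *)
Require Import Defs.
From Stdlib Require Import Reals Lra.
From Coquelicot Require Import Coquelicot.
Open Scope R_scope.

(** * Filters and derivatives relative to an interval *)

Lemma within_locally_proper (I : R -> Prop) (s : R) :
  I s -> ProperFilter (within I (locally s)).
Proof.
  intros Hs; constructor.
  - intros P HP; exists s; exact (locally_singleton _ _ HP Hs).
  - apply within_filter, locally_filter.
Qed.

Lemma is_filter_lim_within (I : R -> Prop) (s : R) :
  is_filter_lim (within I (locally s)) s.
Proof. intros P; apply filter_le_within. Qed.

(** [filterdiff] quantifies over every limit of its filter, and a finer filter could have more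
    limits. Properness of [G] forces each of them to be [x], where the estimate along [F] carries
    over. *)
Lemma filterdiff_filter_le {U V : NormedModule R_AbsRing}
    (F G : (U -> Prop) -> Prop) (f l : U -> V) (x : U) :
  ProperFilter' G -> filter_le G F -> is_filter_lim F x ->
  filterdiff f F l -> filterdiff f G l.
Proof.
  intros HG Hle Hx [Hl Hf]; split; [exact Hl|].
  intros y Hy eps; apply Hle.
  rewrite (is_filter_lim_unique (F := G) y x Hy (is_filter_lim_filter_le x Hle Hx)).
  exact (Hf x Hx eps).
Qed.

Section Derivatives.

Context {V : NormedModule R_AbsRing}.

(** Since [u] is continuous at [s] relative to [I] and sends [I] into [J], the image under [u] of
    the filter at [s] within [I] is finer than the filter at [u s] within [J], so the composition
    rule for [filterdiff] applies. *)
Lemma is_derive_in_comp (I J : R -> Prop) (f : R -> V) (u : R -> R) (s d : R)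
    (l : V) :
  I s -> (forall x, I x -> J (u x)) ->
  is_derive_in I (V := R_NormedModule) u s d -> is_derive_in J f (u s) l ->
  is_derive_in I (fun x => f (u x)) s (scal d l).
Proof.
  intros Hs HIJ Hu Hf.
  pose proof (within_locally_proper I s Hs) as HF.
  apply (filterdiff_ext_lin (fun x => f (u x)) (fun h : R => scal (scal h d) l)).
  - apply (filterdiff_comp u f _ (fun k => scal k l) Hu).
    apply (filterdiff_filter_le (U := R_NormedModule) (within J (locally (u s)))
             _ _ _ (u s)); try exact Hf.
    + apply filtermap_proper_filter' with (1 := Proper_StrongProper _ HF).
    + intros P HP.
      pose proof (filterdiff_continuous_aux u
        (ex_intro (fun k => filterdiff u (within I (locally s)) k) _ Hu) s
        (is_filter_lim_within I s) _ HP) as Hc.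
      unfold filtermap, within in *.
      revert Hc; apply filter_imp; auto.
    + apply is_filter_lim_within.
  - intros h; apply eq_sym, scal_assoc.
Qed.

Lemma is_derive_in_minus (I : R -> Prop) (f g : R -> V) (s : R) (lf lg : V) :
  is_derive_in I f s lf -> is_derive_in I g s lg ->
  is_derive_in I (fun x => minus (f x) (g x)) s (minus lf lg).
Proof.
  intros Hf Hg.
  apply (filterdiff_ext_lin _ _ _ (filterdiff_minus_fct _ _ _ _ Hf Hg)).
  intros h.
  exact (eq_trans (f_equal (plus (scal h lf)) (eq_sym (scal_opp_r h lg)))
                  (eq_sym (scal_distr_l h lf (opp lg)))).
Qed.

Lemma is_derive_in_linear {W : NormedModule R_AbsRing} (I : R -> Prop)
    (L : V -> W) (f : R -> V) (s : R) (l : V) :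
  is_linear L -> is_derive_in I f s l -> is_derive_in I (fun x => L (f x)) s (L l).
Proof.
  intros HL Hf.
  apply (filterdiff_ext_lin _ _ _
           (filterdiff_comp _ _ _ _ Hf (filterdiff_linear _ HL))).
  intros h; apply (linear_scal L HL).
Qed.

End Derivatives.

(** * Real-valued functions on an interval; product rules for [inner] and [det] *)

Section RealDerivatives.

Local Notation is_derive_in_R I := (is_derive_in I (V := R_NormedModule)).

(** Nondegeneracy and convexity of [I] give points [y <> s] of [I] arbitrarily close to [s], even
    when [s] is an endpoint. There the first-order remainder is [|y - s| * |l|], which exceeds the
    tolerance [|l| / 2 * |y - s|] unless [l = 0]. *)
Lemma is_derive_in_const_eq0 (I : R -> Prop) (f : R -> R) (k s l : R) :
  interval_containing_0 I -> I s -> (forall x, I x -> f x = k) ->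
  is_derive_in_R I f s l -> l = 0.
Proof.
  intros (HI0 & (z & HIz & Hz) & Hconv) Hs Hf [_ Hl].
  assert (Hw : exists w, I w /\ w <> s).
  { destruct (Req_dec s 0) as [->|H0]; [exists z | exists 0]; auto. }
  destruct Hw as (w & HIw & Hws).
  destruct (Req_dec l 0) as [|Hl0]; [assumption | exfalso].
  assert (Heps : 0 < Rabs l / 2) by (apply Rabs_pos_lt in Hl0; lra).
  destruct (Hl s (is_filter_lim_within I s) (mkposreal _ Heps)) as [d Hd].
  pose proof (cond_pos d) as Hdpos.
  assert (Habs : 0 < Rabs (w - s)) by (apply Rabs_pos_lt; lra).
  (* The bound [1] keeps [y] between [s] and [w], hence in [I]; the other bound puts [y] within
     [d / 2] of [s]. *)
  set (r := Rmin 1 (d / 2 / Rabs (w - s))).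
  assert (Hr : 0 < r).
  { apply Rmin_pos; [lra|]. apply Rdiv_lt_0_compat; lra. }
  assert (Hr1 : r <= 1) by apply Rmin_l.
  assert (Hrd : r * Rabs (w - s) < d).
  { apply Rle_lt_trans with (d / 2 / Rabs (w - s) * Rabs (w - s)).
    - apply Rmult_le_compat_r; [lra | apply Rmin_r].
    - field_simplify; lra. }
  set (y := s + r * (w - s)).
  assert (Hys : Rabs (y - s) = r * Rabs (w - s)).
  { replace (y - s) with (r * (w - s)) by (unfold y; ring).
    rewrite Rabs_mult, (Rabs_pos_eq r); lra. }
  assert (HIy : I y).
  { destruct (Rle_dec s w).
    - apply (Hconv s w); auto; unfold y; nra.
    - apply (Hconv w s); auto; unfold y; nra. }
  assert (Hb : ball s d y) by (change (Rabs (y - s) < d); lra).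
  specialize (Hd y Hb HIy).
  rewrite (Hf y HIy), (Hf s Hs) in Hd.
  change (Rabs (k - k - (y - s) * l) <= Rabs l / 2 * Rabs (y - s)) in Hd.
  replace (k - k - (y - s) * l) with (- ((y - s) * l)) in Hd by ring.
  rewrite Rabs_Ropp, Rabs_mult, Hys in Hd.
  assert (0 < r * Rabs (w - s)) by nra.
  nra.
Qed.

Lemma is_derive_in_ext (I : R -> Prop) (f g : R -> R) (s l k : R) :
  I s -> (forall x, I x -> f x = g x) -> l = k ->
  is_derive_in_R I f s l -> is_derive_in_R I g s k.
Proof.
  intros Hs Hfg <-.
  pose proof (within_locally_proper I s Hs) as HF.
  apply (filterdiff_ext_loc (V := R_NormedModule) f g).
  - apply (filter_forall (F := locally s)); exact Hfg.
  - intros x Hx.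
    rewrite (is_filter_lim_unique (F := within I (locally s)) x s Hx
               (is_filter_lim_within I s)); auto.
Qed.

(** Multiplication on pairs is differentiated along the image filter of [(f, g)], which converges to
    [(f s, g s)] because differentiability gives continuity. *)
Lemma is_derive_in_mult (I : R -> Prop) (f g : R -> R) (s lf lg : R) :
  I s -> is_derive_in_R I f s lf -> is_derive_in_R I g s lg ->
  is_derive_in_R I (fun x => f x * g x) s (lf * g s + f s * lg).
Proof.
  intros Hs Hf Hg.
  pose proof (within_locally_proper I s Hs) as HF.
  assert (Hfc := filterdiff_continuous_aux f
    (ex_intro (fun k => filterdiff f (within I (locally s)) k) _ Hf) s
    (is_filter_lim_within I s)).
  assert (Hgc := filterdiff_continuous_aux g
    (ex_intro (fun k => filterdiff g (within I (locally s)) k) _ Hg) s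
    (is_filter_lim_within I s)).
  refine (filterdiff_ext_lin _ _ _ (filterdiff_comp_2 f g (fun a b => a * b)
    _ _ (fun h k => h * g s + f s * k) Hf Hg _) _).
  - apply (filterdiff_mult (K := R_AbsRing) (f s, g s)).
    + intros P HP.
      assert (Hp := filterlim_pair f g Hfc Hgc).
      apply Hp. 
      (* A neighbourhood in the product space contains a product of two balls, as [filter_prod]
         requires. *)
      destruct HP as [eps Heps].
      exists (fun y => ball (f s) eps y) (fun y => ball (g s) eps y);
        try apply locally_ball.
      intros a b Ha Hb; apply Heps; split; assumption.
    + exact Rmult_comm.
  - intros h; unfold scal; simpl; unfold mult; simpl; ring.
Qed.

Lemma is_derive_in_plus (I : R -> Prop) (f g : R -> R) (s lf lg : R) :
  is_derive_in_R I f s lf -> is_derive_in_R I g s lg ->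
  is_derive_in_R I (fun x => f x + g x) s (lf + lg).
Proof.
  intros Hf Hg.
  apply (filterdiff_ext_lin _ _ _ (filterdiff_plus_fct _ _ _ _ Hf Hg)).
  intros h; apply eq_sym, Rmult_plus_distr_l.
Qed.

Lemma is_derive_in_x1 (I : R -> Prop) (f : R -> R31) (s : R) (l : R31) :
  is_derive_in I f s l -> is_derive_in_R I (fun x => x1 (f x)) s (x1 l).
Proof.
  exact (is_derive_in_linear (W := R_NormedModule) I x1 f s l
           (is_linear_comp _ _ is_linear_fst is_linear_fst)).
Qed.

Lemma is_derive_in_x2 (I : R -> Prop) (f : R -> R31) (s : R) (l : R31) :
  is_derive_in I f s l -> is_derive_in_R I (fun x => x2 (f x)) s (x2 l).
Proof.
  exact (is_derive_in_linear (W := R_NormedModule) I x2 f s l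
           (is_linear_comp _ _ is_linear_fst is_linear_snd)).
Qed.

Lemma is_derive_in_x3 (I : R -> Prop) (f : R -> R31) (s : R) (l : R31) :
  is_derive_in I f s l -> is_derive_in_R I (fun x => x3 (f x)) s (x3 l).
Proof.
  exact (is_derive_in_linear (W := R_NormedModule) I x3 f s l is_linear_snd).
Qed.

Lemma is_derive_in_Rminus (I : R -> Prop) (f g : R -> R) (s lf lg : R) :
  is_derive_in_R I f s lf -> is_derive_in_R I g s lg ->
  is_derive_in_R I (fun x => f x - g x) s (lf - lg).
Proof. exact (is_derive_in_minus (V := R_NormedModule) I f g s lf lg). Qed.

Ltac derive_components Hs :=
  lazymatch goal with
  | |- is_derive_in _ (fun x => _ - _) _ _ =>
      apply is_derive_in_Rminus; derive_components Hs
  | |- is_derive_in _ (fun x => _ + _) _ _ =>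
      apply is_derive_in_plus; derive_components Hs
  | |- is_derive_in _ (fun x => _ * _) _ _ =>
      apply is_derive_in_mult; [exact Hs | |]; derive_components Hs
  | |- is_derive_in _ (fun x => x1 _) _ _ => apply is_derive_in_x1; eassumption
  | |- is_derive_in _ (fun x => x2 _) _ _ => apply is_derive_in_x2; eassumption
  | |- is_derive_in _ (fun x => x3 _) _ _ => apply is_derive_in_x3; eassumption
  end.

Lemma is_derive_in_inner (I : R -> Prop) (f g : R -> R31) (s : R) (lf lg : R31) :
  I s -> is_derive_in I f s lf -> is_derive_in I g s lg ->
  is_derive_in_R I (fun x => inner (f x) (g x)) s
    (inner lf (g s) + inner (f s) lg).
Proof.
  intros Hs Hf Hg.
  (* The timelike term goes last, as a subtraction, since [derive_components] has no case for a
     leading minus sign. *)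
  eapply (is_derive_in_ext I
    (fun x => x2 (f x) * x2 (g x) + x3 (f x) * x3 (g x) - x1 (f x) * x1 (g x)));
    [exact Hs | | | derive_components Hs].
  - intros x _; unfold inner; ring.
  - unfold inner; simpl; ring.
Qed.

Lemma is_derive_in_det (I : R -> Prop) (f g h : R -> R31) (s : R)
    (lf lg lh : R31) :
  I s -> is_derive_in I f s lf -> is_derive_in I g s lg -> is_derive_in I h s lh ->
  is_derive_in_R I (fun x => det (f x) (g x) (h x)) s
    (det lf (g s) (h s) + det (f s) lg (h s) + det (f s) (g s) lh).
Proof.
  intros Hs Hf Hg Hh.
  eapply (is_derive_in_ext I);
    [exact Hs | intros x _; reflexivity | | unfold det; derive_components Hs].
  unfold det; simpl; ring.
Qed.

End RealDerivatives.

(** * Lorentzian vector algebra, checked in coordinates *)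

Ltac lorentz :=
  unfold darboux_g, inner, det, cross, x1, x2, x3, minus, plus, opp, scal; simpl;
  unfold plus, opp, scal; simpl; unfold mult, plus, opp; simpl; ring.

Lemma inner_comm (a b : R31) : inner a b = inner b a.
Proof. lorentz. Qed.

Lemma inner_plus_l (a b d : R31) : inner (plus a b) d = inner a d + inner b d.
Proof. lorentz. Qed.

Lemma inner_plus_r (a b d : R31) : inner a (plus b d) = inner a b + inner a d.
Proof. lorentz. Qed.

Lemma inner_minus_l (a b d : R31) : inner (minus a b) d = inner a d - inner b d.
Proof. lorentz. Qed.

Lemma inner_scal_l (k : R) (a b : R31) : inner (scal k a) b = k * inner a b.
Proof. lorentz. Qed.

Lemma inner_scal_r (k : R) (a b : R31) : inner a (scal k b) = k * inner a b.
Proof. lorentz. Qed.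

Lemma inner_cross_minus_l (a b d u : R31) :
  inner (cross (minus a b) d) u = inner (cross a d) u - inner (cross b d) u.
Proof. lorentz. Qed.

(** Lagrange's identity, with the sign opposite to the Euclidean one. *)
Lemma inner_cross_cross (a b p q : R31) :
  inner (cross a b) (cross p q) = inner a q * inner b p - inner a p * inner b q.
Proof. lorentz. Qed.

(** This is Lagrange's identity again: the minus signs in [det a b d = - inner (cross a b) d] and in
    [darboux_g] cancel. *)
Lemma det_darboux_g (a b e t : R31) :
  det a b (darboux_g e t) = inner a t * inner b e - inner a e * inner b t.
Proof. lorentz. Qed.

Lemma inner_darboux_g (e t : R31) :
  inner (darboux_g e t) (darboux_g e t)
  = inner e t * inner e t - inner e e * inner t t.
Proof. lorentz. Qed.

Lemma inner_darboux_g_e (e t : R31) : inner (darboux_g e t) e = 0.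
Proof. lorentz. Qed.

Lemma inner_darboux_g_t (e t : R31) : inner (darboux_g e t) t = 0.
Proof. lorentz. Qed.

(** Equal moments give [cross (minus a b) p = 0]; pairing this with [cross p u] leaves only
    [inner (minus a b) u], by Lagrange's identity. *)
Lemma inner_minus_eq0 (a b p u : R31) :
  cross a p = cross b p -> inner p p = 1 -> inner p u = 0 ->
  inner (minus a b) u = 0.
Proof.
  intros Hab Hp Hu.
  pose proof (inner_cross_cross (minus a b) p p u) as H.
  rewrite inner_cross_minus_l, Hab, Hp, Hu in H; lra.
Qed.

(** The last hypothesis is the dual part of the relation expressing the second ruling in the first
    frame, with [th'] the dual part of the angle. *)
Lemma offset_distance (c c1 e t : R31) (th th' : R) :
  inner e e = 1 -> inner t t = -1 -> inner e t = 0 ->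
  cross c1 (plus (scal (sinh th) e) (scal (cosh th) t))
  = plus (plus (scal (sinh th) (cross c e)) (scal (th' * cosh th) e))
      (plus (scal (cosh th) (cross c t)) (scal (th' * sinh th) t)) ->
  th' = inner (minus c1 c) (darboux_g e t).
Proof.
  intros Hee Htt Het H.
  assert (Hch : cosh th * cosh th - sinh th * sinh th = 1).
  { unfold cosh, sinh. pose proof (exp_plus th (- th)) as E.
    rewrite Rplus_opp_r, exp_0 in E. nra. }
  (* Pairing both moments with g1 = cosh th e + sinh th t isolates [th']. *)
  apply (f_equal (fun v =>
    inner v (plus (scal (cosh th) e) (scal (sinh th) t)))) in H.
  (* The triple product is alternating in its last two vectors, so passing from the pair [e], [t] to
     [e1], [g1] only multiplies it, up to sign, by the determinant of the hyperbolic
     coefficients. *)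
  assert (L : inner (cross c1 (plus (scal (sinh th) e) (scal (cosh th) t)))
      (plus (scal (cosh th) e) (scal (sinh th) t))
    = (cosh th * cosh th - sinh th * sinh th) * inner c1 (darboux_g e t))
    by lorentz.
  assert (M : inner (plus (plus (scal (sinh th) (cross c e))
        (scal (th' * cosh th) e))
      (plus (scal (cosh th) (cross c t)) (scal (th' * sinh th) t)))
      (plus (scal (cosh th) e) (scal (sinh th) t))
    = (cosh th * cosh th - sinh th * sinh th) * inner c (darboux_g e t)
      + th' * (cosh th * cosh th * inner e e + sinh th * sinh th * inner t t
               + 2 * (sinh th * cosh th) * inner e t))
    by lorentz.
  rewrite L, M, Hee, Htt, Het, Hch in H.
  rewrite inner_minus_l.
  replace (th' * _) with th' in H; [lra|].
  transitivity (th' * (cosh th * cosh th - sinh th * sinh th)); [|ring].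
  rewrite Hch; ring.
Qed.

Theorem corollary5p3
  (I J : R -> Prop)
  (c e dc t : R -> R31) (gamma : R -> R)
  (c1 e1 dc1 t1 : R -> R31)
  (s1 : R -> R) (theta theta_star : R -> R)
  (Hphi : spacelike_ruled_surface I c e dc t)
  (Hgamma : conical_curvature I e t gamma)
  (Hphi1 : timelike_ruled_surface J c1 e1 dc1 t1)
  (Hoffset : mannheim_offset I J c e t c1 t1 s1)
  (Htheta : dual_offset_angle I c e t c1 e1 t1 s1 theta theta_star)
  (s : R) (Hs : I s) :
  surf_Delta dc1 e1 t1 (s1 s)
  = - theta_star s * tanh (theta s) + surf_delta dc e s / gamma s.
Proof.
  destruct Hphi as [Hdom _ _ Hdc Ht Hee Htt Hdct].
  destruct Hphi1 as [_ _ _ Hdc1 Ht1 _ _ _].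
  destruct Hoffset as [HIJ Hreg Hoff].
  destruct (Hreg s Hs) as (d & Hd & Hs1).
  pose proof (HIJ s Hs) as HJs.
  (* Obtained by differentiating [inner e e = 1]. *)
  assert (Het : forall x, I x -> inner (e x) (t x) = 0).
  { intros x Hx.
    assert (H : inner (t x) (e x) + inner (e x) (t x) = 0).
    { apply (is_derive_in_const_eq0 I _ 1 x _ Hdom Hx Hee).
      apply is_derive_in_inner; auto. }
    rewrite (inner_comm (t x)) in H; lra. }
  assert (Hgg : forall x, I x ->
    inner (darboux_g (e x) (t x)) (darboux_g (e x) (t x)) = 1).
  { intros x Hx; rewrite inner_darboux_g, Het, Hee, Htt; auto; ring. }
  assert (He1 : forall x, I x -> e1 (s1 x)
    = plus (scal (sinh (theta x)) (e x)) (scal (cosh (theta x)) (t x))).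
  { intros x Hx; destruct (Htheta x Hx) as [H _]; exact (f_equal fst H). }
  assert (Ht1g : forall x, I x -> t1 (s1 x) = darboux_g (e x) (t x)).
  { intros x Hx; exact (eq_sym (f_equal fst (Hoff x Hx))). }
  assert (Hcross : forall x, I x ->
    cross (c1 (s1 x)) (darboux_g (e x) (t x))
    = cross (c x) (darboux_g (e x) (t x))).
  { intros x Hx.
    pose proof (f_equal snd (Hoff x Hx)) as H; simpl in H.
    rewrite Ht1g in H; auto. }
  assert (Hstar : theta_star s
    = inner (minus (c1 (s1 s)) (c s)) (darboux_g (e s) (t s))).
  { apply (offset_distance _ _ _ _ (theta s)); auto.
    rewrite <- He1 by exact Hs.
    destruct (Htheta s Hs) as [H _]; apply (f_equal snd) in H; simpl in H.
    (* The [Derive] terms produced by [dual_ext] become [cosh] and [sinh]. *)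
    rewrite (is_derive_unique _ _ _ (proj2 (is_derive_Reals _ _ _)
      (derivable_pt_lim_sinh (theta s)))) in H.
    rewrite (is_derive_unique _ _ _ (proj2 (is_derive_Reals _ _ _)
      (derivable_pt_lim_cosh (theta s)))) in H.
    exact H. }
  assert (Hdiff : is_derive_in I (fun x => minus (c1 (s1 x)) (c x)) s
    (minus (scal d (dc1 (s1 s))) (dc s))).
  { apply is_derive_in_minus; [|auto].
    apply (is_derive_in_comp I J); auto. }
  (* The remaining product-rule term [<D, t>] vanishes because [t] is orthogonal to [g]. *)
  assert (HE : d * inner (dc1 (s1 s)) (e s) = inner (dc s) (e s)).
  { assert (H := is_derive_in_const_eq0 I _ 0 s _ Hdom Hs
      (fun x Hx => inner_minus_eq0 _ _ _ (e x) (Hcross x Hx) (Hgg x Hx)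
         (inner_darboux_g_e _ _))
      (is_derive_in_inner I _ e s _ _ Hs Hdiff (Ht s Hs))).
    cbv beta in H.
    rewrite (inner_minus_eq0 _ _ _ (t s) (Hcross s Hs) (Hgg s Hs)
      (inner_darboux_g_t _ _)), inner_minus_l, inner_scal_l in H; lra. }
  (* Here [t' = e + gamma g] contributes [gamma theta_star] through [<D, g>], and the striction
     condition removes [<dc, t>]. *)
  assert (HT : d * inner (dc1 (s1 s)) (t s) = - (gamma s * theta_star s)).
  { assert (H := is_derive_in_const_eq0 I _ 0 s _ Hdom Hs
      (fun x Hx => inner_minus_eq0 _ _ _ (t x) (Hcross x Hx) (Hgg x Hx)
         (inner_darboux_g_t _ _))
      (is_derive_in_inner I _ t s _ _ Hs Hdiff (Hgamma s Hs))).
    cbv beta in H.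
    rewrite inner_plus_r, inner_scal_r, <- Hstar,
      (inner_minus_eq0 _ _ _ (e s) (Hcross s Hs) (Hgg s Hs)
      (inner_darboux_g_e _ _)), inner_minus_l, inner_scal_l, Hdct in H;
      [lra | exact Hs]. }
  (* In the derivative of [det (e1, e, t)], the first term is [d * det (g, e, t) = d], the second
     has a repeated vector, and the third is [gamma * <e1, t> = - gamma * cosh theta]. *)
  assert (Hspeed : d = gamma s * cosh (theta s)).
  { assert (H : det (scal d (t1 (s1 s))) (e s) (t s)
        + det (e1 (s1 s)) (t s) (t s)
        + det (e1 (s1 s)) (e s)
            (plus (e s) (scal (gamma s) (darboux_g (e s) (t s)))) = 0).
    { apply (is_derive_in_const_eq0 I
        (fun x => det (e1 (s1 x)) (e x) (t x)) 0 s); auto.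
      - intros x Hx; rewrite He1 by exact Hx; lorentz.
      - apply (is_derive_in_det I (fun x => e1 (s1 x)) e t); auto.
        apply (is_derive_in_comp I J); auto. }
    assert (E : det (scal d (darboux_g (e s) (t s))) (e s) (t s)
      = d * inner (darboux_g (e s) (t s)) (darboux_g (e s) (t s))) by lorentz.
    assert (F : det (e1 (s1 s)) (t s) (t s) = 0) by lorentz.
    assert (G : det (e1 (s1 s)) (e s)
            (plus (e s) (scal (gamma s) (darboux_g (e s) (t s))))
      = gamma s * det (e1 (s1 s)) (e s) (darboux_g (e s) (t s))) by lorentz.
    rewrite Ht1g, E, F, G, det_darboux_g, He1, Hgg in H by exact Hs.
    rewrite !inner_plus_l, !inner_scal_l, Hee, Htt, (inner_comm (t s)), Het in H
      by exact Hs.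
    lra. }
  assert (HD : surf_Delta dc1 e1 t1 (s1 s)
    = sinh (theta s) * inner (dc1 (s1 s)) (t s)
      + cosh (theta s) * inner (dc1 (s1 s)) (e s)).
  { unfold surf_Delta; rewrite Ht1g, det_darboux_g, He1 by exact Hs.
    rewrite !inner_plus_l, !inner_scal_l, Hee, Htt, (inner_comm (t s)), Het
      by exact Hs.
    ring. }
  assert (Hch : cosh (theta s) <> 0) by (intros E; rewrite E in Hspeed; lra).
  assert (Hga : gamma s <> 0) by (intros E; rewrite E in Hspeed; lra).
  unfold surf_delta, tanh.
  (* Multiplying by [d = gamma * cosh theta] clears both denominators and lets [HE] and [HT] replace
     the products of [d] with components of [dc1]. *)
  apply (Rmult_eq_reg_l d); [|exact Hd].
  transitivity (cosh (theta s) * inner (dc s) (e s)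
                - sinh (theta s) * (gamma s * theta_star s)).
  - rewrite HD, <- HE.
    replace (gamma s * theta_star s)
      with (- (d * inner (dc1 (s1 s)) (t s))) by lra.
    ring.
  - rewrite Hspeed; field; auto.
Qed.
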